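(* Let $t=(t_n)_{n\ge 0}$ be a sequence with $t_n\neq 0$ for all $n$, and let $T=(T_n)_{n\ge0}$ with $T_n=t_{n+1}$. For a sequence $s=(s_n)$ let $p_n(x,s)$ denote the polynomials defined by $p_{-1}(x,s)=0$, $p_0(x,s)=1$, $p_n(x,s)=x\,p_{n-1}(x,s)-s_{n-2}\,p_{n-2}(x,s)$ for $n\ge1$. Let $\Lambda$ be the linear functional on polynomials with $\Lambda(p_n(x,t))=[n=0]$ for all $n\ge0$, let $a(n)=\Lambda(x^{2n})$, $r(n,x)=\sum_{k=0}^n a(n-k)x^k$ and $d(n,x)=\det\big(r(i+j,x)\big)_{i,j=0}^n$. Then for all $n\ge 0$, $$\frac{d(n,x^2)}{d(n,0)}=\frac{(-1)^n}{t_1t_3\cdots t_{2n-1}}\,p_{2n}(x,T).$$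
   Context: $[n=0]$ denotes $1$ if $n=0$ and $0$ otherwise. $d(n,0)=\det(a(i+j))_{i,j=0}^n$, which is nonzero in this setting. For $n=0$ the empty product $t_1\cdots t_{2n-1}$ equals $1$. *)

(* Defs.v *)
From mathcomp Require Import all_boot all_order all_algebra.

Set Implicit Arguments.
Unset Strict Implicit.
Unset Printing Implicit Defensive.

Import GRing.Theory.
Local Open Scope ring_scope.

(* p s n is p_n(x, s) with x = 'X; the case n = 1 is the recurrence
   p_1 = x p_0 - s_{-1} p_{-1} with p_{-1} = 0, so s_{-1} plays no role. *)
Fixpoint p (F : fieldType) (s : nat -> F) (n : nat) : {poly F} :=
  match n with
  | 0 => 1
  | m.+1 => match m with
            | 0 => 'X
            | k.+1 => 'X * p s m - s k *: p s k
            end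
  end.

Definition moment (F : fieldType) (L : {scalar {poly F}}) (n : nat) : F :=
  L 'X^(n.*2).

Definition r (F : fieldType) (a : nat -> F) (n : nat) : {poly F} :=
  \sum_(k < n.+1) a (n - k)%N *: 'X^k.

(* The determinant has order n + 1: both indices run over 0, ..., n. *)
Definition d (F : fieldType) (a : nat -> F) (n : nat) : {poly F} :=
  \det (\matrix_(i < n.+1, j < n.+1) r a (i + j)%N).

(* Main.v *)
Require Import Defs.
From mathcomp Require Import all_boot all_order all_algebra.
From mathcomp Require Import ring zify.

Set Implicit Arguments.
Unset Strict Implicit.
Unset Printing Implicit Defensive.

Import GRing.Theory.
Local Open Scope ring_scope.

(** The identity r(m+1) = x r(m) + a(m+1) shows that subtracting x
    times each column from the next one turns the columns j > 0 of
    (r(i+j, x)) into Hankel columns a(i+j) without changing the determinant.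
    Now take the row combinations given by the coefficients of
    p_{2i+1}(x, t) = x C_i(x^2).  By orthogonality the Hankel columns become
    triangular, with diagonal entries t_0 ... t_{2i}, and the first column,
    evaluated at x^2, becomes Lambda_y ((p_{2i+1}(x) - p_{2i+1}(y)) / (x - y)),
    which is the associated polynomial p_{2i}(x, T).  Expanding along the last row,
    d(n, x^2) = (-1)^n (prod_{i < n} t_0 ... t_{2i}) p_{2n}(x, T), and the
    value at x = 0 fixes the constant. *)

Arguments p : simpl never.

Lemma pSS (F : fieldType) (s : nat -> F) (n : nat) :
  p s n.+2 = 'X * p s n.+1 - s n *: p s n.
Proof. by []. Qed.

Lemma p0 (F : fieldType) (s : nat -> F) : p s 0 = 1.
Proof. by []. Qed.

Lemma p1 (F : fieldType) (s : nat -> F) : p s 1 = 'X.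
Proof. by []. Qed.

Lemma nat_ind2 (P : nat -> Prop) :
  P 0%N -> P 1%N -> (forall n, P n -> P n.+1 -> P n.+2) -> forall n, P n.
Proof.
move=> P0 P1 PSS n; suff [] : P n /\ P n.+1 by [].
by elim: n => [|n [Pn PSn]]; split=> //; apply: PSS.
Qed.

Lemma coef_p_parity (F : fieldType) (s : nat -> F) (n k : nat) :
  odd (n + k) -> (p s n)`_k = 0.
Proof.
elim/nat_ind2: n k => [|| n IHn IHSn] k.
- by case: k => // k _; rewrite coefC.
- by rewrite coefX; case: k => [|[|k]].
rewrite pSS coefB coefZ coefXM => odd_nk; rewrite IHn; last by lia.
by case: k odd_nk => [|k] odd_nk /=; rewrite ?IHSn ?mulr0 ?subr0 //; lia.
Qed.

Lemma coef_p_gt (F : fieldType) (s : nat -> F) (n k : nat) :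
  (n < k)%N -> (p s n)`_k = 0.
Proof.
elim/nat_ind2: n k => [|| n IHn IHSn] [|k] //.
- by rewrite coefC.
- by rewrite coefX; case: k.
move=> lt_nk; rewrite pSS coefB coefZ coefXM /= IHn ?IHSn ?mulr0 ?subr0 //.
by lia.
Qed.

Lemma coef_p_lead (F : fieldType) (s : nat -> F) (n : nat) : (p s n)`_n = 1.
Proof.
elim/nat_ind2: n => [|| n IHn IHSn]; rewrite ?coefC ?coefX //.
by rewrite pSS coefB coefZ coefXM /= IHSn coef_p_gt ?mulr0 ?subr0 //; lia.
Qed.

(** By parity only odd powers occur. The sum is padded to [n] so that all rows [i <= n] share one
    index range. *)
Lemma p_odd_sum (F : fieldType) (s : nat -> F) (n i : nat) : (i <= n)%N ->
  p s i.*2.+1 =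
  \sum_(k < n.+1) (p s i.*2.+1)`_k.*2.+1 *: 'X^(k.*2.+1).
Proof.
move=> le_in; apply/polyP=> m; rewrite coef_sum.
under eq_bigr do rewrite coefZ coefXn.
have [odd_m|even_m] := boolP (odd m); last first.
  rewrite coef_p_parity; last by lia.
  rewrite big1 // => k _; case: eqP => [mE|_]; last by rewrite mulr0.
  by lia.
have [lt_nm|le_mn] := ltnP n m./2.
  rewrite coef_p_gt; last by lia.
  rewrite big1 // => k _; case: eqP => [mE|_]; last by rewrite mulr0.
  by have := ltn_ord k; lia.
have mE : m = (m./2).*2.+1 by lia.
rewrite (bigD1 (Ordinal (le_mn : (m./2 < n.+1)%N))) //= -mE eqxx mulr1.
rewrite big1 ?addr0 // => k /eqP neq_k; case: eqP => [mk|_]; last first.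
  by rewrite mulr0.
by case: neq_k; apply/val_inj => /=; lia.
Qed.

Lemma p_even_at0 (F : fieldType) (s : nat -> F) (n : nat) :
  (p s n.*2).[0] = (-1) ^+ n * \prod_(i < n) s i.*2.
Proof.
elim: n => [|n IHn]; first by rewrite big_ord0 mulr1 hornerC.
rewrite doubleS pSS hornerE hornerM hornerX mul0r add0r hornerN hornerZ IHn.
by rewrite big_ord_recr /= exprS; ring.
Qed.

(** By the recurrence, ['X * p t n.+1] is [p t n.+2 + t n *: p t n]. Each step lowers the exponent;
    the first term dies, and the second contributes a factor [t n] when the exponent equals the
    index. *)
Lemma L_p_Xn (F : fieldType) (t : nat -> F) (L : {scalar {poly F}})
  (L_p : forall n, L (p t n) = (n == 0%N)%:R) (n j : nat) : (j <= n)%N ->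
  L (p t n * 'X^j) = if j == n then \prod_(i < n) t i else 0.
Proof.
elim: j n => [|j IHj] n le_jn.
  by rewrite mulr1 L_p; case: n le_jn => [|n] _; rewrite ?big_ord0.
case: n le_jn => // n le_jn.
have -> : p t n.+1 * 'X^(j.+1) = p t n.+2 * 'X^j + t n *: (p t n * 'X^j).
  by rewrite pSS mulrBl -scalerAl subrK exprS mulrA ['X * _]mulrC.
rewrite linearD linearZ /= !IHj ?[j == _.+2]ltn_eqF ?add0r //; try lia.
by rewrite eqSS; case: eqP => // _; rewrite ?mulr0 // big_ord_recr /= mulrC.
Qed.

(* [q |-> \sum_k L (drop_poly k.+1 q) x^k] is the operator
   [q |-> L_y ((q x - q y) / (x - y))]. *)
Lemma coef_p_shift (F : fieldType) (t : nat -> F) (L : {scalar {poly F}})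
  (L_p : forall n, L (p t n) = (n == 0%N)%:R) (n k : nat) :
  (p (fun m => t m.+1) n)`_k = L (drop_poly k.+1 (p t n.+1)).
Proof.
have dropXM j (q : {poly F}) : drop_poly j.+1 ('X * q) = drop_poly j q.
  by apply/polyP=> i; rewrite !coef_drop_poly coefXM addnS.
have L1 : L 1 = 1 by rewrite (L_p 0%N).
have drop1 j : drop_poly j.+1 (1 : {poly F}) = 0.
  by apply/polyP=> i; rewrite coef_drop_poly coefC addnS coef0.
elim/nat_ind2: n k => [|| n IHn IHSn] k.
- rewrite p0 p1 coefC -['X]mulr1 dropXM; case: k => [|k] /=.
    by rewrite drop_poly0l L1.
  by rewrite drop1 linear0.
- rewrite p1 coefX pSS p0 p1 linearB linearZ /= dropXM drop1 scaler0 subr0.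
  rewrite -['X]mulr1; case: k => [|k].
    by rewrite drop_poly0l mulr1 (L_p 1%N).
  rewrite dropXM; case: k => [|k]; first by rewrite drop_poly0l L1.
  by rewrite drop1 linear0.
rewrite pSS (pSS _ n.+1) coefB coefZ coefXM linearB linearZ /= dropXM.
rewrite linearB linearZ /= -IHn; congr (_ - _).
(* For [k = 0] what remains is [L (p t n.+2)], which vanishes like the constant coefficient of a
   multiple of ['X]. *)
by case: k => [|k] /=; rewrite ?IHSn // drop_poly0l L_p.
Qed.

Lemma rS (F : fieldType) (a : nat -> F) (m : nat) :
  r a m.+1 = 'X * r a m + (a m.+1)%:P.
Proof.
rewrite /r big_ord_recl /= subn0 expr0 alg_polyC addrC; congr (_ + _).
rewrite mulr_sumr; apply: eq_bigr => k _.
by rewrite /bump /= subSS -scalerAr -exprS.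
Qed.

Lemma coef_r (F : fieldType) (a : nat -> F) (m k : nat) :
  (r a m)`_k = if (k <= m)%N then a (m - k)%N else 0.
Proof. by rewrite /r -(poly_def _ (fun k => a (m - k)%N)) coef_poly ltnS. Qed.

Lemma coef_comp_X2 (F : fieldType) (q : {poly F}) (m : nat) :
  (q \Po 'X^2)`_m = if odd m then 0 else q`_m./2.
Proof. by rewrite coef_comp_poly_Xn // dvdn2 divn2; case: odd. Qed.

Definition odd_coef_comb {F : fieldType} (t a : nat -> F) (n i : nat)
  : {poly F} := \sum_(k < n.+1) (p t i.*2.+1)`_k.*2.+1 *: r a k.

(** Compare coefficients of x^(2l): the moment a(k-l) is [L] of x^(2k+1) with its lowest 2l+1 powers
    dropped, so [coef_p_shift] applies termwise. *)
Lemma odd_coef_comb_moment (F : fieldType) (t : nat -> F)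
  (L : {scalar {poly F}}) (L_p : forall n, L (p t n) = (n == 0%N)%:R)
  (n i : nat) : (i <= n)%N ->
  odd_coef_comb t (moment L) n i \Po 'X^2 = p (fun m => t m.+1) i.*2.
Proof.
move=> le_in; apply/polyP=> m; rewrite coef_comp_X2.
have [odd_m|even_m] := boolP (odd m); first by rewrite coef_p_parity //; lia.
rewrite (coef_p_shift L_p) (p_odd_sum t le_in) !linear_sum /= coef_sum.
apply: eq_bigr => k _; rewrite coefZ !linearZ /= coef_r; congr (_ * _).
have [le_mk|lt_km] := leqP m./2 k; last first.
  rewrite (_ : drop_poly _ _ = 0) ?linear0 //; apply/polyP=> j.
  by rewrite coef_drop_poly coefXn coef0; case: eqP => //; lia.
rewrite /moment; congr (L _); apply/polyP=> j.
by rewrite coef_drop_poly !coefXn; congr (_%:R); lia.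
Qed.

Lemma d_moment (F : fieldType) (t : nat -> F) (L : {scalar {poly F}})
  (L_p : forall n, L (p t n) = (n == 0%N)%:R) (n : nat) :
  d (moment L) n =
  ((-1) ^+ n * \prod_(i < n) \prod_(j < i.*2.+1) t j)
    *: odd_coef_comb t (moment L) n n.
Proof.
set a' := moment L.
(* [U] carries the row combinations and [V] the column subtractions; both are triangular with unit
   diagonal. *)
pose U := \matrix_(i < n.+1, k < n.+1) ((p t i.*2.+1)`_k.*2.+1)%:P.
pose R := \matrix_(i < n.+1, j < n.+1) r a' (i + j)%N.
pose V := \matrix_(k < n.+1, j < n.+1)
  ((k == j)%:R - (k.+1 == j :> nat)%:R * 'X) : 'M[{poly F}]_n.+1.
(* The exponent 2j-1 comes from a(k+j) = L(x^(2k+1) x^(2j-1)). *)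
pose W := \matrix_(i < n.+1, j < n.+1)
  if j == 0%N :> nat then odd_coef_comb t a' n i
  else (L (p t i.*2.+1 * 'X^(j.*2.-1)))%:P.
have RV i j : (R *m V) i j =
    if j == 0%N :> nat then r a' i else (a' (i + j)%N)%:P.
  rewrite mxE; under eq_bigr do rewrite !mxE mulrBr.
  rewrite big_split /= (bigD1 j) //= eqxx mulr1 big1 ?addr0; last first.
    by move=> k /negPf ->; rewrite mulr0.
  case: j => [[|j] lt_jn] /=.
    by rewrite addn0 big1 ?addr0 // => k _; rewrite mul0r mulr0 oppr0.
  rewrite (bigD1 (Ordinal (ltnW lt_jn))) //= eqxx mul1r big1; last first.
    move=> k /eqP neq_k; case: eqP => [[kj]|_]; last first.
      by rewrite mul0r mulr0 oppr0.
    by case: neq_k; apply: val_inj.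
  by rewrite addr0 addnS rS mulrC; ring.
have UN : U *m (R *m V) = W.
  apply/matrixP=> i j; rewrite mxE; under eq_bigr => k _ do rewrite RV mxE.
  rewrite mxE; case: eqP => [_|/eqP j_neq0].
    by apply: eq_bigr => k _; rewrite mul_polyC.
  have le_in : (i <= n)%N by rewrite -ltnS.
  rewrite {2}(p_odd_sum t le_in) mulr_suml linear_sum rmorph_sum /=.
  apply: eq_bigr => k _; rewrite -scalerAl linearZ /= polyCM -exprD.
  by rewrite /a' /moment; congr (_ * (L _)%:P); congr ('X^_); lia.
have detU : \det U = 1.
  rewrite det_trig ?big1 // => [i _|]; first by rewrite mxE coef_p_lead.
  by apply/is_trig_mxP=> i j lt_ij; rewrite mxE coef_p_gt //; lia.
have detV : \det V = 1.
  rewrite -det_tr det_trig ?big1 // => [i _|].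
    by rewrite !mxE eqxx gtn_eqF // mul0r subr0.
  apply/is_trig_mxP=> i j lt_ij; rewrite !mxE -val_eqE /= !gtn_eqF //.
    by rewrite mul0r subr0.
  exact: ltnW.
have -> : d a' n = \det W.
  by rewrite -UN !det_mulmx detU detV mul1r mulr1.
(* In the last row 2j-1 < 2n+1 for every column, so only column 0 survives. *)
rewrite (expand_det_row W ord_max) (bigD1 ord0) //= big1 ?addr0; last first.
  move=> j /negPf j_neq0; rewrite mxE -[_ == _ :> nat]/(j == ord0) j_neq0.
  have lt_jn := ltn_ord j.
  rewrite L_p_Xn //=; last by lia.
  by rewrite ltn_eqF ?mul0r //; move/negbT: j_neq0; rewrite -val_eqE /=; lia.
(* The remaining minor has entries L(p_{2i+1} x^(2j+1)), zero for j < i. It is upper triangular,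
   hence the transpose. *)
rewrite mxE /= /cofactor -det_tr det_trig; last first.
  apply/is_trig_mxP=> /= i j lt_ij; rewrite !mxE /= /bump.
  rewrite (leqNgt n) ltn_ord add0n L_p_Xn //=; last by lia.
  by rewrite ltn_eqF //; lia.
rewrite addn0 mulrC -mul_polyC; congr (_ * _).
rewrite polyCM rmorphXn rmorphN1 rmorph_prod /=; congr (_ * _).
apply: eq_bigr => i _; rewrite !mxE /= /bump (leqNgt n) ltn_ord add0n.
by rewrite L_p_Xn //= eqxx.
Qed.

Theorem theorem1 (F : fieldType) (t : nat -> F)
  (t_neq0 : forall n : nat, t n != 0)
  (L : {scalar {poly F}})
  (L_p : forall n : nat, L (p t n) = (n == 0%N)%:R)
  (n : nat) :
  ((d (moment L) n).[0])^-1 *: (d (moment L) n \Po 'X^2) =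
  ((-1) ^+ n / \prod_(i < n) t (i.*2.+1)) *: p (fun m : nat => t m.+1) n.*2.
Proof.
set c := (-1) ^+ n * \prod_(i < n) \prod_(j < i.*2.+1) t j.
have c_neq0 : c != 0.
  rewrite mulf_neq0 ?signr_eq0 //; apply/prodf_neq0 => i _.
  by apply/prodf_neq0.
have dX2 : d (moment L) n \Po 'X^2 = c *: p (fun m => t m.+1) n.*2.
  by rewrite (d_moment L_p) linearZ /= (odd_coef_comb_moment L_p).
(* Since x^2 vanishes at 0, the formula [dX2] also gives d(n,0). *)
have -> : (d (moment L) n).[0] = (d (moment L) n \Po 'X^2).[0].
  by rewrite horner_comp hornerXn expr0n.
(* The factor [c] cancels, leaving the inverse of p_{2n}(0,T) = (-1)^n t_1 t_3 ... t_{2n-1}. *)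
rewrite dX2 hornerZ p_even_at0 scalerA; congr (_ *: _).
by rewrite invfM mulrAC mulVf // mul1r invfM invr_sign.
Qed.
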